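(* Let $k$ be a commutative ring, let $A$ be a Hopf subalgebra of a Hopf algebra $E$ over $k$, let $H$ be an $A$-complement of $E$, and let $(A, H, \triangleright, \triangleleft)$ be the associated canonical matched pair. Then: (1) The relation $\sim$ (equivalence of deformation maps) is an equivalence relation on the set $\mathcal{DM}(H, A \mid (\triangleright, \triangleleft))$ of all deformation maps of the matched pair $(A,H,\triangleright,\triangleleft)$. Denote by $\mathcal{HA}^2(H, A \mid (\triangleright,\triangleleft))$ the quotient set $\mathcal{DM}(H, A \mid (\triangleright, \triangleleft))/\sim$. (2) There exists a bijection between the set of isomorphism classes (as Hopf algebras) of all $A$-complements of $E$ and $\mathcal{HA}^2(H, A \mid (\triangleright,\triangleleft))$. In particular, the factorization index of $A$ in $E$ is $$[E : A]^f = |\mathcal{HA}^2(H, A \mid (\triangleright,\triangleleft))|.$$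
   Context: All coalgebras, Hopf algebras and tensor products are over a commutative ring $k$; Sweedler notation $\Delta(c)=c_{(1)}\otimes c_{(2)}$ is used. A Hopf subalgebra of $E$ is a Hopf algebra inclusion $A\subseteq E$ that splits $k$-linearly. An $A$-complement of $E$ is a Hopf subalgebra $H\subseteq E$ such that the multiplication map $A\otimes H\to E$, $a\otimes h\mapsto ah$, is bijective. The factorization index $[E:A]^f$ is the cardinality of the set of Hopf algebra isomorphism classes of $A$-complements of $E$. A matched pair of Hopf algebras $(A,H,\triangleright,\triangleleft)$ consists of Hopf algebras $A,H$ and coalgebra maps $\triangleleft:H\otimes A\to H$, $\triangleright:H\otimes A\to A$ such that $(H,\triangleleft)$ is a right $A$-module coalgebra, $(A,\triangleright)$ is a left $H$-module coalgebra, and for all $a,b\in A$, $g,h\in H$: $h\triangleright 1_A=\varepsilon_H(h)1_A$; $1_H\triangleleft a=\varepsilon_A(a)1_H$; $g\triangleright(ab)=(g_{(1)}\triangleright a_{(1)})\bigl((g_{(2)}\triangleleft a_{(2)})\triangleright b\bigr)$; $(gh)\triangleleft a=\bigl(g\triangleleft(h_{(1)}\triangleright a_{(1)})\bigr)(h_{(2)}\triangleleft a_{(2)})$; $g_{(1)}\triangleleft a_{(1)}\otimes g_{(2)}\triangleright a_{(2)}=g_{(2)}\triangleleft a_{(2)}\otimes g_{(1)}\triangleright a_{(1)}$. If $H$ is an $A$-complement of $E$, the associated canonical matched pair $(A,H,\triangleright,\triangleleft)$ is the matched pair determined by $ha=(h_{(1)}\triangleright a_{(1)})(h_{(2)}\triangleleft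 a_{(2)})$ in $E$, for all $a\in A$, $h\in H$; explicitly, if $m:A\otimes H\to E$ is the multiplication map, then $h\triangleright a=(\mathrm{Id}_A\otimes\varepsilon_H)(m^{-1}(ha))$ and $h\triangleleft a=(\varepsilon_A\otimes\mathrm{Id}_H)(m^{-1}(ha))$. A deformation map of a matched pair $(A,H,\triangleright,\triangleleft)$ is a coalgebra map $r:H\to A$ with $r(1_H)=1_A$ which is cocentral, i.e. $r(h_{(1)})\otimes h_{(2)}=r(h_{(2)})\otimes h_{(1)}$ for all $h\in H$, and satisfies, for all $g,h\in H$, $$r\bigl((h\triangleleft r(g_{(1)}))\,g_{(2)}\bigr)=r(h_{(1)})\,\bigl(h_{(2)}\triangleright r(g)\bigr).$$ Two deformation maps $r,R:H\to A$ are equivalent, $r\sim R$, if there exists a coalgebra automorphism $\sigma:H\to H$ with $\sigma(1_H)=1_H$ such that for all $g,h\in H$ $$\sigma\bigl((h\triangleleft r(g_{(1)}))\,g_{(2)}\bigr)=\bigl(\sigma(h)\triangleleft R(\sigma(g_{(1)}))\bigr)\,\sigma(g_{(2)}).$$ *)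

(* Defs.v *)
From HB Require Import structures.
From mathcomp Require Import all_boot all_order all_algebra.
From mathcomp Require Import all_classical.

Set Implicit Arguments.
Unset Strict Implicit.
Unset Printing Implicit Defensive.

Import GRing.Theory.
Local Open Scope ring_scope.
Local Open Scope quotient_scope.

Reserved Notation "m ⊗ n" (at level 40, left associativity).
Notation "x ∙ y" := (x * y)%g (at level 38, left associativity).
Reserved Notation "\tsum_ ( x , y <- t ) F"
  (at level 41, F at level 41, x name, y name, t at level 50,
   format "'[' \tsum_ ( x ,  y  <-  t ) '/  '  F ']'").

(* M ⊗ N is the set of finite formal sums of pairs (m, n) modulo the additive
   congruence generated by the bilinearity relations; the additive inverse of
   (m, n) is (- m, n). *)
Inductive tensor_rel (R : comPzRingType) (M N : lmodType R) :
    seq (M * N) -> seq (M * N) -> Prop :=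
  | tensor_rel_refl s : tensor_rel s s
  | tensor_rel_sym s t : tensor_rel s t -> tensor_rel t s
  | tensor_rel_trans s t u : tensor_rel s t -> tensor_rel t u -> tensor_rel s u
  | tensor_rel_cat s s' t t' :
      tensor_rel s s' -> tensor_rel t t' -> tensor_rel (s ++ t) (s' ++ t')
  | tensor_rel_comm s t : tensor_rel (s ++ t) (t ++ s)
  | tensor_rel_0l n : tensor_rel [:: (0, n)] [::]
  | tensor_rel_Dl m m' n : tensor_rel [:: (m + m', n)] [:: (m, n); (m', n)]
  | tensor_rel_Dr m n n' : tensor_rel [:: (m, n + n')] [:: (m, n); (m, n')]
  | tensor_rel_Z a m n : tensor_rel [:: (a *: m, n)] [:: (m, a *: n)].

Section TensorDef.
Variables (R : comPzRingType) (M N : lmodType R).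
Implicit Types s t : seq (M * N).

Let tensor_relb : rel (seq (M * N)) := fun s t => `[< tensor_rel s t >].

Fact tensor_relb_equiv : equiv_class_of tensor_relb.
Proof.
split=> [s|s t|t s u].
- exact/asboolP/tensor_rel_refl.
- by apply/asboolP/asboolP; apply: tensor_rel_sym.
- by move=> /asboolP ? /asboolP ?; apply/asboolP; apply: tensor_rel_trans; eassumption.
Qed.
Definition tensor_equiv : equiv_rel (seq (M * N)) :=
  EquivRelPack tensor_relb_equiv.

Definition tensor : Type := {eq_quot tensor_equiv}.
HB.instance Definition _ := Choice.on tensor.
HB.instance Definition _ := Quotient.on tensor.

Lemma tensor_eqP s t : \pi_tensor s = \pi_tensor t <-> tensor_rel s t.
Proof.
split=> [/eqquotP/asboolP //|?].
by apply/eqquotP/asboolP.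
Qed.

Lemma tensorW (P : tensor -> Prop) :
  (forall s, P (\pi_tensor s)) -> forall x, P x.
Proof. by move=> Ps x; rewrite -[x]reprK. Qed.

Definition tpure (m : M) (n : N) : tensor := \pi_tensor [:: (m, n)].
Definition tadd (x y : tensor) : tensor := \pi_tensor (repr x ++ repr y).
Definition tscale (a : R) (x : tensor) : tensor :=
  \pi_tensor [seq (a *: p.1, p.2) | p <- repr x].

Lemma tensor_rel_map a s t : tensor_rel s t ->
  tensor_rel [seq (a *: p.1, p.2) | p <- s] [seq (a *: p.1, p.2) | p <- t].
Proof.
elim=> {s t}.
- by move=> *; apply: tensor_rel_refl.
- by move=> *; apply: tensor_rel_sym.
- by move=> *; apply: tensor_rel_trans; eassumption.
- by move=> *; rewrite !map_cat; apply: tensor_rel_cat.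
- by move=> *; rewrite !map_cat; apply: tensor_rel_comm.
- by move=> n /=; rewrite scaler0; apply: tensor_rel_0l.
- by move=> m m' n /=; rewrite scalerDr; apply: tensor_rel_Dl.
- by move=> m n n' /=; apply: tensor_rel_Dr.
- move=> b m n /=; rewrite scalerA mulrC -scalerA; exact: tensor_rel_Z.
Qed.

Lemma tadd_pi s t : tadd (\pi_tensor s) (\pi_tensor t) = \pi_tensor (s ++ t).
Proof.
by apply/tensor_eqP/tensor_rel_cat; apply/tensor_eqP; rewrite reprK.
Qed.

Lemma tscale_pi a s :
  tscale a (\pi_tensor s) = \pi_tensor [seq (a *: p.1, p.2) | p <- s].
Proof. by apply/tensor_eqP/tensor_rel_map/tensor_eqP; rewrite reprK. Qed.

Lemma tensor_rel_scaleD a b s : tensor_rel [seq ((a + b) *: p.1, p.2) | p <- s]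
  ([seq (a *: p.1, p.2) | p <- s] ++ [seq (b *: p.1, p.2) | p <- s]).
Proof.
elim: s => [|[m n] s IHs] /=; first exact: tensor_rel_refl.
rewrite scalerDl.
apply: tensor_rel_trans (tensor_rel_cat (tensor_rel_Dl _ _ _) IHs) _.
set u := map _ _; set v := map _ _; set x := (a *: m, n).
set y := (b *: m, n).
change (tensor_rel ([:: x] ++ (([:: y] ++ u) ++ v)) ([:: x] ++ (u ++ ([:: y] ++ v)))).
apply: (@tensor_rel_cat _ _ _ [:: x] [:: x]); first exact: tensor_rel_refl.
rewrite [u ++ (_ ++ _)]catA.
apply: tensor_rel_cat; last exact: tensor_rel_refl.
exact: tensor_rel_comm.
Qed.

Lemma tensor_rel_scale0 s : tensor_rel [seq (0 *: p.1, p.2) | p <- s] [::].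
Proof.
elim: s => [|[m n] s IHs] /=; first exact: tensor_rel_refl.
by rewrite scale0r; apply: tensor_rel_trans (tensor_rel_cat (tensor_rel_0l _ _) IHs) _;
  apply: tensor_rel_refl.
Qed.

Fact taddA : associative tadd.
Proof.
elim/tensorW=> s; elim/tensorW=> t; elim/tensorW=> u.
by rewrite !tadd_pi catA.
Qed.
Fact taddC : commutative tadd.
Proof.
elim/tensorW=> s; elim/tensorW=> t; rewrite !tadd_pi.
exact/tensor_eqP/tensor_rel_comm.
Qed.
Fact tadd0 : left_id (\pi_tensor [::]) tadd.
Proof. by elim/tensorW=> s; rewrite tadd_pi. Qed.
Fact taddN : left_inverse (\pi_tensor [::]) (tscale (-1)) tadd.
Proof.
elim/tensorW=> s; rewrite tscale_pi tadd_pi; apply/tensor_eqP.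
have -> : s = [seq (1 *: p.1, p.2) | p <- s].
  by rewrite -[LHS]map_id; apply: eq_map => -[m n]; rewrite scale1r.
rewrite -map_comp (eq_map (g := fun p => ((-1) *: p.1, p.2))); last first.
  by move=> [m n] /=; rewrite scale1r.
apply: tensor_rel_trans (tensor_rel_sym (tensor_rel_scaleD _ _ _)) _.
rewrite addNr; exact: tensor_rel_scale0.
Qed.

HB.instance Definition _ :=
  GRing.isZmodule.Build tensor taddA taddC tadd0 taddN.

Lemma tensor_addE s t : \pi_tensor s + \pi_tensor t = \pi_tensor (s ++ t).
Proof. exact: tadd_pi. Qed.

Fact tscaleA a b v : tscale a (tscale b v) = tscale (a * b) v.
Proof.
elim/tensorW: v => s; rewrite !tscale_pi -map_comp; congr (\pi_tensor _).
by apply: eq_map => p /=; rewrite scalerA.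
Qed.
Fact tscale1 : left_id 1 tscale.
Proof.
elim/tensorW=> s; rewrite tscale_pi -[in RHS](map_id s); congr (\pi_tensor _).
by apply: eq_map => -[m n] /=; rewrite scale1r.
Qed.
Fact tscaleDr : right_distributive tscale +%R.
Proof.
move=> a; elim/tensorW=> s; elim/tensorW=> t.
by rewrite tensor_addE !tscale_pi map_cat tensor_addE.
Qed.
Fact tscaleDl v : {morph tscale^~ v : a b / a + b}.
Proof.
move=> a b; elim/tensorW: v => s; rewrite !tscale_pi tensor_addE.
exact/tensor_eqP/tensor_rel_scaleD.
Qed.

HB.instance Definition _ :=
  GRing.Zmodule_isLmodule.Build R tensor tscaleA tscale1 tscaleDr tscaleDl.

End TensorDef.

Notation "M ⊗ N" := (tensor M%type N%type) : type_scope.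
Notation "m ⊗ n" := (tpure m n) : ring_scope.

Definition bilin (R : comPzRingType) (M N P : lmodType R) (f : M -> N -> P) :=
  (forall n, linear (f^~ n)) /\ (forall m, linear (f m)).

(* For a bilinear f, the map induced by f on M ⊗ N: the sum of the f m n over
   any expression of t as a sum of pure tensors (tlift_pure and tlift_linear
   below).  It is only meaningful for bilinear f; keeping it total lets
   Sweedler sums be written with no side proof. *)
Definition tlift (R : comPzRingType) (M N P : lmodType R)
    (f : M -> N -> P) (t : M ⊗ N) : P :=
  \sum_(p <- repr t) f p.1 p.2.

Notation "\tsum_ ( x , y <- t ) F" := (tlift (fun x y => F) t) : ring_scope.

Section LinearFun.
Variables (R : pzRingType) (U V : lmodType R) (f : U -> V).
Hypothesis lf : linear f.

Definition mk_linear : {linear U -> V} :=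
  HB.pack f (GRing.isLinear.Build R U V *:%R f lf).

Lemma mk_linearE x : mk_linear x = f x. Proof. by []. Qed.
Lemma linfD x y : f (x + y) = f x + f y.
Proof. exact: (raddfD mk_linear). Qed.
Lemma linfZ a x : f (a *: x) = a *: f x.
Proof. exact: (linearZZ mk_linear). Qed.
Lemma linf0 : f 0 = 0.
Proof. exact: (raddf0 mk_linear). Qed.
Lemma linf_sum I (r : seq I) (P : pred I) F :
  f (\sum_(i <- r | P i) F i) = \sum_(i <- r | P i) f (F i).
Proof. exact: (raddf_sum mk_linear). Qed.
End LinearFun.

Section TensorTheory.
Variables (R : comPzRingType) (M N : lmodType R).
Implicit Types (P Q : lmodType R) (t : M ⊗ N).

Lemma bilinP P (f : M -> N -> P) :
  (forall m m' n, f (m + m') n = f m n + f m' n) ->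
  (forall a m n, f (a *: m) n = a *: f m n) ->
  (forall m n n', f m (n + n') = f m n + f m n') ->
  (forall a m n, f m (a *: n) = a *: f m n) -> bilin f.
Proof. by move=> Dl Zl Dr Zr; split=> x a y z; rewrite ?Dl ?Zl ?Dr ?Zr. Qed.

Lemma tlift_pi P (f : M -> N -> P) s : bilin f ->
  tlift f (\pi_(M ⊗ N) s) = \sum_(p <- s) f p.1 p.2.
Proof.
case=> lf rf; rewrite /tlift.
have: tensor_rel (repr (\pi_(M ⊗ N) s)) s by apply/tensor_eqP; rewrite reprK.
move: (repr _) => u; elim=> {u s}.
- by [].
- by move=> s t _ ->.
- by move=> s t u _ -> _ ->.
- by move=> s s' t t' _ e _ e'; rewrite !big_cat /= e e'.
- by move=> s t; rewrite !big_cat /= addrC.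
- by move=> n; rewrite big_seq1 big_nil /= (linf0 (lf n)).
- by move=> m m' n; rewrite big_seq1 big_cons big_seq1 /= (linfD (lf n)).
- by move=> m n n'; rewrite big_seq1 big_cons big_seq1 /= (linfD (rf m)).
- by move=> a m n; rewrite !big_seq1 /= (linfZ (lf n)) (linfZ (rf m)).
Qed.

Lemma tlift_pure P (f : M -> N -> P) m n : bilin f -> tlift f (m ⊗ n) = f m n.
Proof. by move=> bf; rewrite tlift_pi // big_seq1. Qed.

Lemma tlift_linear P (f : M -> N -> P) : bilin f -> linear (tlift f).
Proof.
move=> bf a; elim/tensorW=> s; elim/tensorW=> t.
have -> : a *: \pi_(M ⊗ N) s = tscale a (\pi_(M ⊗ N) s) by [].
rewrite tscale_pi tensor_addE !tlift_pi // big_cat big_map /= scaler_sumr.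
by congr (_ + _); apply: eq_bigr => p _; rewrite (linfZ (bf.1 _)).
Qed.

Lemma tpure_bilin : bilin (@tpure R M N).
Proof.
apply: bilinP => [m m' n|a m n|m n n'|a m n].
- by rewrite tensor_addE; apply/tensor_eqP/tensor_rel_Dl.
- have -> : a *: (m ⊗ n) = tscale a (m ⊗ n) by [].
  by rewrite tscale_pi.
- by rewrite tensor_addE; apply/tensor_eqP/tensor_rel_Dr.
- have -> : a *: (m ⊗ n) = tscale a (m ⊗ n) by [].
  by rewrite tscale_pi; apply/tensor_eqP/tensor_rel_sym/tensor_rel_Z.
Qed.

Lemma tpureDl (m m' : M) (n : N) : (m + m') ⊗ n = m ⊗ n + m' ⊗ n.
Proof. exact: (linfD (tpure_bilin.1 n)). Qed.
Lemma tpureDr (m : M) (n n' : N) : m ⊗ (n + n') = m ⊗ n + m ⊗ n'.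
Proof. exact: (linfD (tpure_bilin.2 m)). Qed.
Lemma tpureZl a (m : M) (n : N) : (a *: m) ⊗ n = a *: (m ⊗ n).
Proof. exact: (linfZ (tpure_bilin.1 n)). Qed.
Lemma tpureZr a (m : M) (n : N) : m ⊗ (a *: n) = a *: (m ⊗ n).
Proof. exact: (linfZ (tpure_bilin.2 m)). Qed.

Lemma tensor_pureE t : t = \tsum_(m, n <- t) m ⊗ n.
Proof.
elim/tensorW: t => s; rewrite (tlift_pi _ tpure_bilin).
elim: s => [|[m n] s IHs]; first by rewrite big_nil.
by rewrite big_cons -IHs tensor_addE.
Qed.

Lemma linear_tlift P Q (g : P -> Q) (f : M -> N -> P) t : linear g ->
  g (\tsum_(m, n <- t) f m n) = \tsum_(m, n <- t) g (f m n).
Proof. by move=> lg; rewrite /tlift (linf_sum lg). Qed.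

Lemma linear_tensorE P (g : M ⊗ N -> P) t : linear g ->
  g t = \tsum_(m, n <- t) g (m ⊗ n).
Proof. by move=> lg; rewrite {1}[t]tensor_pureE linear_tlift. Qed.

Lemma linear_tensor_ext P (g h : M ⊗ N -> P) : linear g -> linear h ->
  (forall m n, g (m ⊗ n) = h (m ⊗ n)) -> g =1 h.
Proof.
move=> lg lh gh t; rewrite (linear_tensorE _ lg) (linear_tensorE _ lh).
by apply: eq_bigr.
Qed.

Lemma eq_tlift P (f g : M -> N -> P) t : f =2 g -> tlift f t = tlift g t.
Proof. by move=> fg; apply: eq_bigr => p _; apply: fg. Qed.

Lemma exchange_tlift (M' N' P : lmodType R) (f : M -> N -> M' -> N' -> P) t
    (t' : M' ⊗ N') :
  \tsum_(m, n <- t) \tsum_(m', n' <- t') f m n m' n' =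
  \tsum_(m', n' <- t') \tsum_(m, n <- t) f m n m' n'.
Proof. exact: exchange_big. Qed.

Lemma tliftD P (f g : M -> N -> P) t :
  \tsum_(m, n <- t) (f m n + g m n) =
  \tsum_(m, n <- t) f m n + \tsum_(m, n <- t) g m n.
Proof. exact: big_split. Qed.

Lemma tliftZ P a (f : M -> N -> P) t :
  \tsum_(m, n <- t) (a *: f m n) = a *: \tsum_(m, n <- t) f m n.
Proof. by rewrite /tlift scaler_sumr. Qed.

End TensorTheory.


Section LinearCombinators.
Variables (R : comPzRingType) (U : lmodType R).
Implicit Types (M N P : lmodType R).

Lemma lin_id : linear (fun z : U => z). Proof. by []. Qed.

Lemma lin_comp M P (f : {linear M -> P}) (g : U -> M) :
  linear g -> linear (fun z => f (g z)).
Proof. by move=> lg a x y; rewrite lg linearP. Qed.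

Lemma lin_tsum M N P (f : U -> M -> N -> P) (t : M ⊗ N) :
  (forall m n, linear (fun z => f z m n)) -> linear (fun z => tlift (f z) t).
Proof.
move=> lf a x y; rewrite -tliftZ -tliftD; apply: eq_tlift => m n.
exact: lf.
Qed.

Lemma lin_tlift M N P (f : M -> N -> P) (g : U -> M ⊗ N) :
  bilin f -> linear g -> linear (fun z => tlift f (g z)).
Proof. by move=> bf lg a x y; rewrite lg (tlift_linear bf). Qed.

Lemma lin_tpurel M N (g : U -> M) (n : N) :
  linear g -> linear (fun z => g z ⊗ n).
Proof. by move=> lg a x y; rewrite lg tpureDl tpureZl. Qed.

Lemma lin_tpurer M N (g : U -> N) (m : M) :
  linear g -> linear (fun z => m ⊗ g z).
Proof. by move=> lg a x y; rewrite lg tpureDr tpureZr. Qed.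

Lemma lin_scalel M (g : U -> R^o) (m : M) :
  linear g -> linear (fun z => g z *: m).
Proof. by move=> lg a x y; rewrite lg scalerDl -scalerA. Qed.

Lemma lin_scaler M (g : U -> M) b : linear g -> linear (fun z => b *: g z).
Proof.
by move=> lg a x y; rewrite lg scalerDr !scalerA mulrC.
Qed.

End LinearCombinators.

HB.mixin Record isCoalgebra (k : comPzRingType) C of GRing.Lmodule k C := {
  comul : {linear C -> (C ⊗ C)%type};
  counit : {linear C -> k^o};
  comulA : forall c : C,
    \tsum_(c1, c2 <- comul c) \tsum_(d1, d2 <- comul c1) d1 ⊗ (d2 ⊗ c2) =
    \tsum_(c1, c2 <- comul c) c1 ⊗ comul c2;
  counitl : forall c : C, \tsum_(c1, c2 <- comul c) (counit c1 *: c2) = c;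
  counitr : forall c : C, \tsum_(c1, c2 <- comul c) (counit c2 *: c1) = c
}.
#[short(type="coalgType")]
HB.structure Definition Coalgebra (k : comPzRingType) :=
  {C of GRing.Lmodule k C & isCoalgebra k C}.


(* A k-algebra, as a monoid (with unit 1%g) on a k-module whose product is
   bilinear.  MathComp's algType is not used because it requires 1 != 0, hence
   a nonzero k, and the hierarchy admits no join of lmodType and pzRingType. *)
HB.mixin Record isAssocAlgebra (k : comPzRingType) A
    of monoid.Monoid A & GRing.Lmodule k A := {
  amulDl : forall x y z : A, (x + y) ∙ z = x ∙ z + y ∙ z;
  amulDr : forall x y z : A, x ∙ (y + z) = x ∙ y + x ∙ z;
  amulZl : forall (c : k) (x y : A), (c *: x) ∙ y = c *: (x ∙ y);
  amulZr : forall (c : k) (x y : A), x ∙ (c *: y) = c *: (x ∙ y)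
}.
#[short(type="assocAlgType")]
HB.structure Definition AssocAlgebra (k : comPzRingType) :=
  {A of monoid.Monoid A & GRing.Lmodule k A & isAssocAlgebra k A}.

Section AlgebraTheory.
Variables (k : comPzRingType) (A : assocAlgType k).
Implicit Types x y z : A.
Lemma amulA x y z : x ∙ (y ∙ z) = x ∙ y ∙ z. Proof. exact: monoid.mulgA. Qed.
Lemma amul1r x : 1%g ∙ x = x. Proof. exact: monoid.mul1g. Qed.
Lemma amulr1 x : x ∙ 1%g = x. Proof. exact: monoid.mulg1. Qed.
End AlgebraTheory.

Section AlgebraLinear.
Variables (k : comPzRingType) (U : lmodType k) (A : assocAlgType k).

Lemma lin_mull (g : U -> A) (y : A) : linear g -> linear (fun z => g z ∙ y).
Proof. by move=> lg a u v; rewrite lg amulDl amulZl. Qed.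

Lemma lin_mulr (g : U -> A) (x : A) : linear g -> linear (fun z => x ∙ g z).
Proof. by move=> lg a u v; rewrite lg amulDr amulZr. Qed.

End AlgebraLinear.

(* Proves linear and bilin goals by structural recursion on the body. *)
Ltac lin_step :=
  match goal with
  | |- bilin _ => split=> ?
  | |- linear (fun z => z) => exact: lin_id
  | |- linear (fun z => tlift (@?f z) ?t) => apply: lin_tsum => ? ?
  | |- linear (fun z => tlift ?f (@?g z)) => apply: lin_tlift
  | |- linear (fun z => tpure (@?f z) ?n) => apply: lin_tpurel
  | |- linear (fun z => tpure ?m (@?g z)) => apply: lin_tpurer
  | |- linear (fun z => GRing.scale ?b (@?g z)) => apply: lin_scaler
  | |- linear (fun z => GRing.scale (@?g z) ?m) => apply: lin_scalel
  | |- linear (fun z => (@?g z) ∙ ?y) => apply: lin_mull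
  | |- linear (fun z => ?x ∙ (@?g z)) => apply: lin_mulr
  | |- linear (fun z => (GRing.Linear.sort ?f) (@?g z)) => apply: lin_comp
  | |- linear (tpure ?m) => exact: (lin_tpurer _ (@lin_id _ _))
  | |- linear (GRing.scale ?b) => exact: (lin_scaler _ (@lin_id _ _))
  | |- linear (monoid.mul ?x) => exact: (lin_mulr _ (@lin_id _ _))
  | |- linear (tlift ?f) => apply: tlift_linear
  | |- linear (GRing.Linear.sort ?f) => exact: (lin_comp _ (@lin_id _ _))
  | _ => assumption
  end.
Ltac lin := repeat (lin_step; cbv beta).

Section Coassociativity.
Variables (k : comPzRingType) (C : coalgType k) (P : lmodType k).

Lemma coassoc (f : C -> C -> C -> P) (c : C) :
  (forall y z, linear (fun x => f x y z)) ->
  (forall x z, linear (fun y => f x y z)) ->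
  (forall x y, linear (fun z => f x y z)) ->
  \tsum_(c1, c2 <- comul c) \tsum_(d1, d2 <- comul c1) f d1 d2 c2 =
  \tsum_(c1, c2 <- comul c) \tsum_(d1, d2 <- comul c2) f c1 d1 d2.
Proof.
move=> f1 f2 f3.
have bf x : bilin (f x) by split=> y; [exact: (f2 x y)|exact: f3].
have bF : bilin (fun x (t : C ⊗ C) => tlift (f x) t).
  split=> [t|x]; last exact: tlift_linear.
  by apply: lin_tsum => y z; apply: f1.
have := congr1 (tlift (fun x (t : C ⊗ C) => tlift (f x) t)) (comulA c).
rewrite !(linear_tlift _ _ (tlift_linear bF)) => e.
transitivity (\tsum_(c1, c2 <- comul c)
  tlift (fun x t => tlift (f x) t) (\tsum_(d1, d2 <- comul c1) d1 ⊗ (d2 ⊗ c2))).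
  apply: eq_tlift => c1 c2; rewrite (linear_tlift _ _ (tlift_linear bF)).
  by apply: eq_tlift => d1 d2; rewrite !tlift_pure.
rewrite e; apply: eq_tlift => c1 c2; by rewrite tlift_pure.
Qed.

End Coassociativity.

Section TensorCoalgebra.
Variables (k : comPzRingType) (C D : coalgType k).

Definition tcomul_fun (c : C) (d : D) : (C ⊗ D) ⊗ (C ⊗ D) :=
  \tsum_(c1, c2 <- comul c) \tsum_(d1, d2 <- comul d) (c1 ⊗ d1) ⊗ (c2 ⊗ d2).
Definition tcounit_fun (c : C) (d : D) : k^o := counit c *: counit d.

Lemma tcomul_bilin : bilin tcomul_fun.
Proof. rewrite /tcomul_fun; by lin. Qed.
Lemma tcounit_bilin : bilin tcounit_fun.
Proof. rewrite /tcounit_fun; by lin. Qed.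

Definition tcomul : {linear (C ⊗ D)%type -> (C ⊗ D ⊗ (C ⊗ D))%type} :=
  mk_linear (tlift_linear tcomul_bilin).
Definition tcounit : {linear (C ⊗ D)%type -> k^o} :=
  mk_linear (tlift_linear tcounit_bilin).

Lemma tcomulE c d : tcomul (c ⊗ d) =
  \tsum_(c1, c2 <- comul c) \tsum_(d1, d2 <- comul d) (c1 ⊗ d1) ⊗ (c2 ⊗ d2).
Proof. exact: tlift_pure tcomul_bilin. Qed.
Lemma tcounitE c d : tcounit (c ⊗ d) = counit c *: counit d.
Proof. exact: tlift_pure tcounit_bilin. Qed.

Lemma tsum_tcomul (P : lmodType k) (f : C ⊗ D -> C ⊗ D -> P) c d :
  bilin f -> tlift f (tcomul (c ⊗ d)) =
  \tsum_(c1, c2 <- comul c) \tsum_(d1, d2 <- comul d) f (c1 ⊗ d1) (c2 ⊗ d2).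
Proof.
move=> bf; rewrite tcomulE (linear_tlift _ _ (tlift_linear bf)).
apply: eq_tlift => c1 c2; rewrite (linear_tlift _ _ (tlift_linear bf)).
by apply: eq_tlift => d1 d2; rewrite tlift_pure.
Qed.

Fact tcomulA (x : C ⊗ D) :
  \tsum_(c1, c2 <- tcomul x) \tsum_(d1, d2 <- tcomul c1) d1 ⊗ (d2 ⊗ c2) =
  \tsum_(c1, c2 <- tcomul x) c1 ⊗ tcomul c2.
Proof.
move: x; apply: linear_tensor_ext => [||c d]; [by lin|by lin|].
rewrite !tsum_tcomul; [|by lin|by lin].
transitivity (\tsum_(c1, c2 <- comul c) \tsum_(e1, e2 <- comul c1)
  \tsum_(d1, d2 <- comul d) \tsum_(f1, f2 <- comul d1)
  (e1 ⊗ f1) ⊗ ((e2 ⊗ f2) ⊗ (c2 ⊗ d2))).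
  apply: eq_tlift => c1 c2; rewrite exchange_tlift.
  apply: eq_tlift => d1 d2; rewrite tsum_tcomul; [by []|by lin].
rewrite (coassoc (f := fun x y z => \tsum_(d1, d2 <- comul d)
  \tsum_(f1, f2 <- comul d1) (x ⊗ f1) ⊗ ((y ⊗ f2) ⊗ (z ⊗ d2)))); last 3 first.
- by move=> *; lin.
- by move=> *; lin.
- by move=> *; lin.
apply: eq_tlift => c1 c2.
transitivity (\tsum_(e1, e2 <- comul c2) \tsum_(d1, d2 <- comul d)
  \tsum_(f1, f2 <- comul d2) (c1 ⊗ d1) ⊗ ((e1 ⊗ f1) ⊗ (e2 ⊗ f2))).
  by apply: eq_tlift => e1 e2; rewrite coassoc //; move=> *; lin.
rewrite exchange_tlift; apply: eq_tlift => d1 d2.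
rewrite tcomulE (linear_tlift (g := tpure _)); last by lin.
apply: eq_tlift => e1 e2.
by rewrite (linear_tlift (g := tpure _)); last by lin.
Qed.

Fact tcounitl (x : C ⊗ D) :
  \tsum_(c1, c2 <- tcomul x) (tcounit c1 *: c2) = x.
Proof.
move: x; apply: linear_tensor_ext => [||c d]; [by lin|by lin|].
rewrite tsum_tcomul; last by lin.
rewrite -[in RHS](counitl c) -[in RHS](counitl d).
rewrite (linear_tlift (g := fun z => z ⊗ _)); last by lin.
apply: eq_tlift => c1 c2; rewrite (linear_tlift (g := tpure _)); last by lin.
by apply: eq_tlift => d1 d2; rewrite tcounitE tpureZl tpureZr scalerA.
Qed.

Fact tcounitr (x : C ⊗ D) :
  \tsum_(c1, c2 <- tcomul x) (tcounit c2 *: c1) = x.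
Proof.
move: x; apply: linear_tensor_ext => [||c d]; [by lin|by lin|].
rewrite tsum_tcomul; last by lin.
rewrite -[in RHS](counitr c) -[in RHS](counitr d).
rewrite (linear_tlift (g := fun z => z ⊗ _)); last by lin.
apply: eq_tlift => c1 c2; rewrite (linear_tlift (g := tpure _)); last by lin.
by apply: eq_tlift => d1 d2; rewrite tcounitE tpureZl tpureZr scalerA.
Qed.

HB.instance Definition _ :=
  isCoalgebra.Build k (C ⊗ D)%type tcomulA tcounitl tcounitr.

End TensorCoalgebra.

Definition is_coalgebra_map (k : comPzRingType) (C D : coalgType k)
    (f : {linear C -> D}) :=
  (forall c, comul (f c) = \tsum_(c1, c2 <- comul c) f c1 ⊗ f c2) /\
  (forall c, counit (f c) = counit c).

HB.mixin Record isBialgebra (k : comPzRingType) B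
    of Coalgebra k B & AssocAlgebra k B := {
  comulM : forall x y : B, comul (x ∙ y) =
    \tsum_(x1, x2 <- comul x) \tsum_(y1, y2 <- comul y) (x1 ∙ y1) ⊗ (x2 ∙ y2);
  comul1 : comul (1%g : B) = 1%g ⊗ 1%g;
  counitM : forall x y : B, counit (x ∙ y) = counit x *: counit y;
  counit1 : counit (1%g : B) = 1
}.
#[short(type="bialgType")]
HB.structure Definition Bialgebra (k : comPzRingType) :=
  {B of Coalgebra k B & AssocAlgebra k B & isBialgebra k B}.

HB.mixin Record isHopf (k : comPzRingType) H of Bialgebra k H := {
  antipode : {linear H -> H};
  antipodel : forall h : H,
    \tsum_(h1, h2 <- comul h) (antipode h1 ∙ h2) = counit h *: (1%g : H);
  antipoder : forall h : H,
    \tsum_(h1, h2 <- comul h) (h1 ∙ antipode h2) = counit h *: (1%g : H)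
}.
#[short(type="hopfType")]
HB.structure Definition Hopf (k : comPzRingType) :=
  {H of Bialgebra k H & isHopf k H}.

(* A bialgebra map between Hopf algebras automatically commutes with the
   antipodes. *)
Definition is_hopf_map (k : comPzRingType) (H K : hopfType k)
    (f : {linear H -> K}) :=
  [/\ f 1%g = 1%g, forall x y, f (x ∙ y) = f x ∙ f y & is_coalgebra_map f].

Section MatchedPair.
Variables (k : comPzRingType) (A H : hopfType k).

Section Actions.
Variables (lact : {linear (H ⊗ A)%type -> A}) (ract : {linear (H ⊗ A)%type -> H}).
Local Notation "h ▷ a" := (lact (h ⊗ a)) (at level 36, right associativity).
Local Notation "h ◁ a" := (ract (h ⊗ a)) (at level 37, left associativity).

Definition is_right_module_coalgebra :=
  [/\ is_coalgebra_map ract, forall h, h ◁ 1%g = h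
    & forall h a b, h ◁ (a ∙ b) = (h ◁ a) ◁ b].

Definition is_left_module_coalgebra :=
  [/\ is_coalgebra_map lact, forall a, 1%g ▷ a = a
    & forall g h a, (g ∙ h) ▷ a = g ▷ (h ▷ a)].

Record is_matched_pair : Prop := IsMatchedPair {
  mp_right : is_right_module_coalgebra;
  mp_left : is_left_module_coalgebra;
  mp_lact1 : forall h, h ▷ 1%g = (counit h : k) *: (1%g : A);
  mp_ract1 : forall a, 1%g ◁ a = (counit a : k) *: (1%g : H);
  mp_lactM : forall g a b, g ▷ (a ∙ b) =
    \tsum_(g1, g2 <- comul g) \tsum_(a1, a2 <- comul a)
      (g1 ▷ a1) ∙ ((g2 ◁ a2) ▷ b);
  mp_ractM : forall g h a, (g ∙ h) ◁ a =
    \tsum_(h1, h2 <- comul h) \tsum_(a1, a2 <- comul a)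
      (g ◁ (h1 ▷ a1)) ∙ (h2 ◁ a2);
  mp_compat : forall g a,
    \tsum_(g1, g2 <- comul g) \tsum_(a1, a2 <- comul a)
      (g1 ◁ a1) ⊗ (g2 ▷ a2) =
    \tsum_(g1, g2 <- comul g) \tsum_(a1, a2 <- comul a)
      (g2 ◁ a2) ⊗ (g1 ▷ a1)
}.
End Actions.

Record matched_pair := MatchedPair {
  mp_lact : {linear (H ⊗ A)%type -> A};
  mp_ract : {linear (H ⊗ A)%type -> H};
  mpP : is_matched_pair mp_lact mp_ract
}.

Variable mp : matched_pair.
Local Notation "h ▷ a" := (mp_lact mp (h ⊗ a)) (at level 36, right associativity).
Local Notation "h ◁ a" := (mp_ract mp (h ⊗ a)) (at level 37, left associativity).

Record is_deformation_map (r : {linear H -> A}) : Prop := IsDeformationMap {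
  dm_coalgebra : is_coalgebra_map r;
  dm_unit : r 1%g = 1%g;
  dm_cocentral : forall h, \tsum_(h1, h2 <- comul h) (r h1 ⊗ h2) =
    \tsum_(h1, h2 <- comul h) (r h2 ⊗ h1);
  dm_eq : forall g h,
    r (\tsum_(g1, g2 <- comul g) (h ◁ r g1) ∙ g2) =
    \tsum_(h1, h2 <- comul h) r h1 ∙ (h2 ▷ r g)
}.

Record deformation_map := DeformationMap {
  dm_fun :> {linear H -> A};
  dmP : is_deformation_map dm_fun
}.

Definition deformation_equiv (r R : deformation_map) : Prop :=
  exists s : {linear H -> H},
    [/\ bijective s, is_coalgebra_map s, s 1%g = 1%g
      & forall g h, s (\tsum_(g1, g2 <- comul g) (h ◁ r g1) ∙ g2) =
          \tsum_(g1, g2 <- comul g) (s h ◁ R (s g1)) ∙ s g2].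

End MatchedPair.

Definition classes (T : Type) (R : T -> T -> Prop) : set (set T) := range R.

Definition HA2 (k : comPzRingType) (A H : hopfType k) (mp : matched_pair A H) :
    set (set (deformation_map mp)) :=
  classes (@deformation_equiv k A H mp).
Arguments HA2 {k A H} mp.

(* A ⊆ E is given by an inclusion map rather than by a subset of E: over a
   general k the coalgebra structure is part of the data. *)
Record hopf_sub (k : comPzRingType) (E : hopfType k) := HopfSub {
  hopf_sub_sort :> hopfType k;
  incl : {linear hopf_sub_sort -> E};
  incl_hopf : is_hopf_map incl;
  incl_inj : injective incl;
  incl_split : exists p : {linear E -> hopf_sub_sort}, cancel incl p
}.

Section Complement.
Variables (k : comPzRingType) (E : hopfType k).

Definition mul_incl_fun (A H : hopf_sub E) (a : A) (h : H) : E :=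
  incl A a ∙ incl H h.
Lemma mul_incl_bilin A H : bilin (@mul_incl_fun A H).
Proof. by rewrite /mul_incl_fun; lin. Qed.

Definition mul_incl (A H : hopf_sub E) : {linear (A ⊗ H)%type -> E} :=
  mk_linear (tlift_linear (@mul_incl_bilin A H)).
Arguments mul_incl : simpl never.

Record complement (A : hopf_sub E) := Complement {
  compl_sub :> hopf_sub E;
  compl_bij : bijective (mul_incl A compl_sub)
}.

Definition hopf_iso (H K : hopfType k) : Prop :=
  exists2 f : {linear H -> K}, is_hopf_map f & bijective f.

Definition complement_classes (A : hopf_sub E) : set (set (complement A)) :=
  classes (fun H K : complement A => hopf_iso H K).

Arguments complement_classes A : clear implicits.

(* [E : A]^f = |X|.  The index is a possibly infinite cardinal, and the library
   has no type of cardinals, only the relation of equality of cardinals. *)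
Definition has_factorization_index (A : hopf_sub E) (T : Type) (X : set T) :=
  (complement_classes A #= X)%card.
End Complement.
Arguments complement_classes {k E} A.
Arguments has_factorization_index {k E} A {T} X.

Section SweedlerLemmas.
Variable k : comPzRingType.

Lemma tsum_comulM (B : bialgType k) (P : lmodType k) (f : B -> B -> P) x y :
  bilin f -> tlift f (comul (x ∙ y)) =
  \tsum_(x1, x2 <- comul x) \tsum_(y1, y2 <- comul y) f (x1 ∙ y1) (x2 ∙ y2).
Proof.
move=> bf; rewrite comulM (linear_tlift _ _ (tlift_linear bf)).
apply: eq_tlift => x1 x2; rewrite (linear_tlift _ _ (tlift_linear bf)).
by apply: eq_tlift => y1 y2; rewrite tlift_pure.
Qed.

Lemma tsum_comul_map (C D : coalgType k) (g : {linear C -> D})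
    (P : lmodType k) (f : D -> D -> P) c : is_coalgebra_map g -> bilin f ->
  tlift f (comul (g c)) = \tsum_(c1, c2 <- comul c) f (g c1) (g c2).
Proof.
case=> -> _ bf; rewrite (linear_tlift _ _ (tlift_linear bf)).
by apply: eq_tlift => y1 y2; rewrite tlift_pure.
Qed.

Lemma tsum_counitl (C : coalgType k) (P : lmodType k) (f : C -> P) c :
  linear f -> \tsum_(c1, c2 <- comul c) ((counit c1 : k) *: f c2) = f c.
Proof.
move=> lf; rewrite -[in RHS](counitl c) (linear_tlift _ _ lf).
by apply: eq_tlift => c1 c2; rewrite (linfZ lf).
Qed.

Lemma tsum_counitr (C : coalgType k) (P : lmodType k) (f : C -> P) c :
  linear f -> \tsum_(c1, c2 <- comul c) ((counit c2 : k) *: f c1) = f c.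
Proof.
move=> lf; rewrite -[in RHS](counitr c) (linear_tlift _ _ lf).
by apply: eq_tlift => c1 c2; rewrite (linfZ lf).
Qed.
End SweedlerLemmas.

Section Canonical.
Variables (k : comPzRingType) (E : hopfType k) (A : hopf_sub E).
Variable H : complement A.
Local Notation i := (incl A).
Local Notation j := (incl H).

Definition compl_inv (x : E) : A ⊗ H :=
  xget 0 [set t : A ⊗ H | mul_incl A H t = x]%classic.

Lemma mul_inclE a h : mul_incl A H (a ⊗ h) = i a ∙ j h.
Proof. exact: tlift_pure (mul_incl_bilin _ _). Qed.

Lemma compl_invK : cancel compl_inv (mul_incl A H).
Proof.
move=> x; rewrite /compl_inv; case: xgetP => //= nx.
by case: (compl_bij H) => g _ gK; case: (nx (g x)); apply: gK.
Qed.

Lemma mul_inclK : cancel (mul_incl A H) compl_inv.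
Proof. by move=> t; apply: (bij_inj (compl_bij H)); rewrite compl_invK. Qed.

Lemma compl_inv_linear : linear compl_inv.
Proof.
move=> a x y; apply: (bij_inj (compl_bij H)).
by rewrite linearP !compl_invK.
Qed.
Hint Resolve compl_inv_linear : core.

Lemma compl_invE a h : compl_inv (i a ∙ j h) = a ⊗ h.
Proof. by rewrite -mul_inclE mul_inclK. Qed.

(* proj_A = (Id ⊗ ε) m^-1 and proj_H = (ε ⊗ Id) m^-1, for m the multiplication
   map A ⊗ H -> E. *)
Lemma proj_A_linear : linear (fun x : E =>
  \tsum_(a, h <- compl_inv x) ((counit h : k) *: a)).
Proof. by lin. Qed.
Lemma proj_H_linear : linear (fun x : E =>
  \tsum_(a, h <- compl_inv x) ((counit a : k) *: h)).
Proof. by lin. Qed.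
Definition proj_A : {linear E -> A} := mk_linear proj_A_linear.
Definition proj_H : {linear E -> H} := mk_linear proj_H_linear.
Arguments proj_A : simpl never.
Arguments proj_H : simpl never.

Lemma proj_AE a h : proj_A (i a ∙ j h) = (counit h : k) *: a.
Proof. by rewrite mk_linearE compl_invE tlift_pure //; lin. Qed.
Lemma proj_HE a h : proj_H (i a ∙ j h) = (counit a : k) *: h.
Proof. by rewrite mk_linearE compl_invE tlift_pure //; lin. Qed.

Lemma compl_ext (P : lmodType k) (f g : E -> P) : linear f -> linear g ->
  (forall a h, f (i a ∙ j h) = g (i a ∙ j h)) -> f =1 g.
Proof.
move=> lf lg fg x; rewrite -[x]compl_invK.
apply: (@linear_tensor_ext k A H P (fun t => f (mul_incl A H t))
  (fun t => g (mul_incl A H t))).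
- by move=> a u v; rewrite linearP lf.
- by move=> a u v; rewrite linearP lg.
- by move=> a h; rewrite mul_inclE.
Qed.

Lemma tsum_comul_incl (P : lmodType k) (f : E -> E -> P) a h : bilin f ->
  tlift f (comul (i a ∙ j h)) =
  \tsum_(a1, a2 <- comul a) \tsum_(h1, h2 <- comul h)
    f (i a1 ∙ j h1) (i a2 ∙ j h2).
Proof.
move=> [f1 f2].
have [_ _ ci] := incl_hopf A; have [_ _ cj] := incl_hopf H.
rewrite tsum_comulM // (tsum_comul_map _ ci); last first.
  by split=> ?; apply: lin_tsum => ? ?; move=> c u v;
    rewrite (amulDl, amulDr) (amulZl, amulZr) (f1, f2).
apply: eq_tlift => a1 a2; rewrite (tsum_comul_map _ cj) //.
by split=> ? c u v; rewrite amulDr amulZr (f1, f2).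
Qed.

Lemma proj_A_coalgebra : is_coalgebra_map proj_A.
Proof.
have [_ _ [_ ci]] := incl_hopf A; have [_ _ [_ cj]] := incl_hopf H.
split; apply: compl_ext; [by lin|by lin| |by lin|by lin|] => a h.
- rewrite proj_AE linearZZ tsum_comul_incl; last by lin.
  rewrite [comul a in LHS]tensor_pureE -tliftZ; apply: eq_tlift => a1 a2.
  rewrite -(tsum_counitl h (f := fun h => (counit h : k) *: (a1 ⊗ a2))) //;
    last by lin.
  by apply: eq_tlift => h1 h2; rewrite !proj_AE tpureZl tpureZr.
- by rewrite proj_AE linearZZ counitM ci cj; apply: mulrC.
Qed.

Lemma proj_H_coalgebra : is_coalgebra_map proj_H.
Proof.
have [_ _ [_ ci]] := incl_hopf A; have [_ _ [_ cj]] := incl_hopf H.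
split; apply: compl_ext; [by lin|by lin| |by lin|by lin|] => a h.
- rewrite proj_HE linearZZ tsum_comul_incl; last by lin.
  rewrite exchange_tlift.
  rewrite [comul h in LHS]tensor_pureE -tliftZ; apply: eq_tlift => h1 h2.
  rewrite -(tsum_counitl a (f := fun a => (counit a : k) *: (h1 ⊗ h2))) //;
    last by lin.
  by apply: eq_tlift => a1 a2; rewrite !proj_HE tpureZl tpureZr.
- by rewrite proj_HE linearZZ counitM ci cj.
Qed.

Lemma proj_decomp x :
  \tsum_(x1, x2 <- comul x) (i (proj_A x1) ∙ j (proj_H x2)) = x.
Proof.
move: x; apply: compl_ext; [by lin|by lin|] => a h.
rewrite tsum_comul_incl; last by lin.
rewrite -(tsum_counitr a (f := fun a => i a ∙ j h)); last by lin.
apply: eq_tlift => a1 a2.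
rewrite -(tsum_counitl h (f := fun h => (counit a2 : k) *: (i a1 ∙ j h)));
  last by lin.
apply: eq_tlift => h1 h2.
by rewrite proj_AE proj_HE [i _]linearZZ [j _]linearZZ amulZl amulZr.
Qed.

Lemma proj_cocentral x :
  \tsum_(x1, x2 <- comul x) (proj_H x1 ⊗ proj_A x2) =
  \tsum_(x1, x2 <- comul x) (proj_H x2 ⊗ proj_A x1).
Proof.
move: x; apply: compl_ext; [by lin|by lin|] => a h.
rewrite !tsum_comul_incl; [|by lin|by lin].
transitivity (h ⊗ a).
  rewrite -(tsum_counitl a (f := fun a => h ⊗ a)); last by lin.
  apply: eq_tlift => a1 a2.
  rewrite -(tsum_counitr h (f := fun h => (counit a1 : k) *: (h ⊗ a2)));
    last by lin.
  apply: eq_tlift => h1 h2.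
  by rewrite proj_AE proj_HE tpureZl tpureZr !scalerA mulrC.
rewrite -(tsum_counitr a (f := fun a => h ⊗ a)); last by lin.
apply: eq_tlift => a1 a2.
rewrite -(tsum_counitl h (f := fun h => (counit a2 : k) *: (h ⊗ a1)));
  last by lin.
apply: eq_tlift => h1 h2.
by rewrite proj_AE proj_HE tpureZl tpureZr !scalerA mulrC.
Qed.

Lemma incl1 (B : hopf_sub E) : incl B 1%g = 1%g.
Proof. by case: (incl_hopf B). Qed.
Lemma inclM (B : hopf_sub E) x y : incl B (x ∙ y) = incl B x ∙ incl B y.
Proof. by case: (incl_hopf B). Qed.

Lemma proj_A_mulr x h : proj_A (x ∙ j h) = (counit h : k) *: proj_A x.
Proof.
move: x; apply: compl_ext; [by lin|by lin|] => a g.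
by rewrite -amulA -inclM !proj_AE counitM scalerA [in RHS]mulrC.
Qed.

Lemma proj_A_mull a x : proj_A (i a ∙ x) = a ∙ proj_A x.
Proof.
move: x; apply: compl_ext; [by lin|by lin|] => b g.
by rewrite amulA -inclM !proj_AE amulZr.
Qed.

Lemma proj_H_mull a x : proj_H (i a ∙ x) = (counit a : k) *: proj_H x.
Proof.
move: x; apply: compl_ext; [by lin|by lin|] => b g.
by rewrite amulA -inclM !proj_HE counitM scalerA.
Qed.

Lemma proj_H_mulr x h : proj_H (x ∙ j h) = proj_H x ∙ h.
Proof.
move: x; apply: compl_ext; [by lin|by lin|] => a g.
by rewrite -amulA -inclM !proj_HE amulZl.
Qed.

Lemma proj_A_mul x y : proj_A (x ∙ y) = proj_A (x ∙ i (proj_A y)).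
Proof.
move: y; apply: compl_ext; [by lin|by lin|] => a h.
by rewrite [in RHS]proj_AE amulA proj_A_mulr [i (_ *: _)]linearZZ amulZr linearZZ.
Qed.

Lemma proj_H_mul x y : proj_H (x ∙ y) = proj_H (j (proj_H x) ∙ y).
Proof.
move: x; apply: compl_ext; [by lin|by lin|] => a h.
by rewrite [in RHS]proj_HE -amulA proj_H_mull [j (_ *: _)]linearZZ amulZl linearZZ.
Qed.

Lemma proj_A_incl a : proj_A (i a) = a.
Proof. by rewrite -[i a]amulr1 -(incl1 H) proj_AE counit1 scale1r. Qed.
Lemma proj_A_compl h : proj_A (j h) = (counit h : k) *: (1%g : A).
Proof. by rewrite -[j h]amul1r -(incl1 A) proj_AE. Qed.
Lemma proj_H_compl h : proj_H (j h) = h.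
Proof. by rewrite -[j h]amul1r -(incl1 A) proj_HE counit1 scale1r. Qed.
Lemma proj_H_incl a : proj_H (i a) = (counit a : k) *: (1%g : H).
Proof. by rewrite -[i a]amulr1 -(incl1 H) proj_HE. Qed.

Lemma can_lact_bilin : bilin (fun (h : H) (a : A) => proj_A (j h ∙ i a)).
Proof. by lin. Qed.
Lemma can_ract_bilin : bilin (fun (h : H) (a : A) => proj_H (j h ∙ i a)).
Proof. by lin. Qed.

Definition can_lact : {linear (H ⊗ A)%type -> A} :=
  mk_linear (tlift_linear can_lact_bilin).
Definition can_ract : {linear (H ⊗ A)%type -> H} :=
  mk_linear (tlift_linear can_ract_bilin).

Lemma can_lactE h a : can_lact (h ⊗ a) = proj_A (j h ∙ i a).
Proof. exact: tlift_pure can_lact_bilin. Qed.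
Lemma can_ractE h a : can_ract (h ⊗ a) = proj_H (j h ∙ i a).
Proof. exact: tlift_pure can_ract_bilin. Qed.
Arguments can_lact : simpl never.
Arguments can_ract : simpl never.

Lemma tsum_comul_ji (P : lmodType k) (f : E -> E -> P) h a : bilin f ->
  tlift f (comul (j h ∙ i a)) =
  \tsum_(h1, h2 <- comul h) \tsum_(a1, a2 <- comul a)
    f (j h1 ∙ i a1) (j h2 ∙ i a2).
Proof.
move=> [f1 f2].
have [_ _ ci] := incl_hopf A; have [_ _ cj] := incl_hopf H.
rewrite tsum_comulM // (tsum_comul_map _ cj); last first.
  by split=> ?; apply: lin_tsum => ? ?; move=> c u v;
    rewrite (amulDl, amulDr) (amulZl, amulZr) (f1, f2).
apply: eq_tlift => a1 a2; rewrite (tsum_comul_map _ ci) //.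
by split=> ? c u v; rewrite amulDr amulZr (f1, f2).
Qed.

Lemma can_coalgebra (B : coalgType k) (f : {linear (H ⊗ A)%type -> B})
    (p : {linear E -> B}) : is_coalgebra_map p ->
  (forall h a, f (h ⊗ a) = p (j h ∙ i a)) -> is_coalgebra_map f.
Proof.
have [_ _ [_ ci]] := incl_hopf A; have [_ _ [_ cj]] := incl_hopf H.
move=> [pD pe] fE; split; apply: linear_tensor_ext; [by lin|by lin| |by lin|by lin|].
- move=> h a; rewrite fE pD tsum_comul_ji; last by lin.
  rewrite (tsum_tcomul (f := fun x y => f x ⊗ f y)); last by lin.
  by apply: eq_tlift => h1 h2; apply: eq_tlift => a1 a2; rewrite !fE.
- move=> h a; rewrite fE pe counitM ci cj; exact/esym/tcounitE.
Qed.

Lemma can_is_matched_pair : is_matched_pair can_lact can_ract.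
Proof.
split.
- split=> [|h|h a b]; first exact: can_coalgebra proj_H_coalgebra can_ractE.
  + by rewrite can_ractE incl1 amulr1 proj_H_compl.
  + by rewrite !can_ractE inclM amulA [LHS]proj_H_mul.
- split=> [|a|g h a]; first exact: can_coalgebra proj_A_coalgebra can_lactE.
  + by rewrite can_lactE incl1 amul1r proj_A_incl.
  + by rewrite !can_lactE inclM -amulA [LHS]proj_A_mul.
- by move=> h; rewrite can_lactE incl1 amulr1 proj_A_compl.
- by move=> a; rewrite can_ractE incl1 amul1r proj_H_incl.
- move=> g a b; rewrite can_lactE inclM amulA.
  rewrite -[X in X ∙ i b]proj_decomp tsum_comul_ji; last by lin.
  rewrite (linear_tlift (g := fun z => proj_A (z ∙ i b))); last by lin.
  apply: eq_tlift => g1 g2.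
  rewrite (linear_tlift (g := fun z => proj_A (z ∙ i b))); last by lin.
  apply: eq_tlift => a1 a2.
  by rewrite !can_lactE can_ractE -amulA proj_A_mull.
- move=> g h a; rewrite can_ractE inclM -amulA.
  rewrite -[X in _ ∙ X]proj_decomp tsum_comul_ji; last by lin.
  rewrite (linear_tlift (g := fun z => proj_H (j g ∙ z))); last by lin.
  apply: eq_tlift => h1 h2.
  rewrite (linear_tlift (g := fun z => proj_H (j g ∙ z))); last by lin.
  apply: eq_tlift => a1 a2.
  by rewrite !can_ractE can_lactE amulA proj_H_mulr.
- move=> g a; have := proj_cocentral (j g ∙ i a).
  rewrite !tsum_comul_ji; [|by lin|by lin] => e.
  transitivity (\tsum_(g1, g2 <- comul g) \tsum_(a1, a2 <- comul a)
     (proj_H (j g1 ∙ i a1) ⊗ proj_A (j g2 ∙ i a2))).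
    apply: eq_tlift => g1 g2; apply: eq_tlift => a1 a2.
    by rewrite can_lactE can_ractE.
  rewrite e; apply: eq_tlift => g1 g2; apply: eq_tlift => a1 a2.
  by rewrite can_lactE can_ractE.
Qed.

Lemma can_matched_pairE h a : j h ∙ i a =
  \tsum_(h1, h2 <- comul h) \tsum_(a1, a2 <- comul a)
    (i (can_lact (h1 ⊗ a1)) ∙ j (can_ract (h2 ⊗ a2))).
Proof.
rewrite -[LHS]proj_decomp tsum_comul_ji; last by lin.
apply: eq_tlift => g1 g2; apply: eq_tlift => a1 a2.
by rewrite can_lactE can_ractE.
Qed.

Definition canonical_matched_pair : matched_pair A H :=
  MatchedPair can_is_matched_pair.

End Canonical.

(* Main.v *)
Require Import Defs.
From HB Require Import structures.
From mathcomp Require Import all_boot all_order all_algebra.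
From mathcomp Require Import all_classical.

Set Implicit Arguments.
Unset Strict Implicit.
Unset Printing Implicit Defensive.

Import GRing.Theory.
Local Open Scope ring_scope.

(** Fix the complement H, so that E = A ⊗ H with coalgebra projections pA and
    pH onto the factors.  Any other complement K is, as a coalgebra, the same
    as H: both are the quotient of E by the right ideal that the augmentation
    ideal of A generates, so that pH restricts to an isomorphism from K to H
    ([compl_projK]).  Its inverse makes K the image of a coalgebra section w of
    pH, and such a section is determined by its A-component r = pA w: it is the
    graph h |-> r(h_1) h_2 ([graph_proj_A]).

    Deformation maps are exactly the coalgebra maps r for which this graph is
    the embedding of a complement: cocentrality says that the graph is a
    coalgebra map, and the deformation equation says that its image is closed
    under multiplication ([graph_deformation_eq], [deformation_map_of_graph]).  A
    graph with these properties carries a Hopf algebra structure pulled back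
    from E along the retraction pH ([retract_hopf_sub]): every axiom holds
    because it holds in E.  It is a complement since multiplication from A
    tensored with the graph differs from multiplication from A ⊗ H by the
    automorphism a ⊗ h |-> a r(h_1) ⊗ h_2, whose inverse uses the antipode
    of A ([twist_bij]).

    The product pulled back to H from the graph of r is the expression
    (h ◁ r(g_1)) g_2 of the definition of equivalence, so r and R are
    equivalent if and only if their complements are isomorphic Hopf algebras
    ([deformation_equivE]).  Both parts of the theorem then follow formally:
    equivalence is pulled back from isomorphism, and every complement is
    isomorphic to the one given by some r ([compl_iso]). *)

(** * Coalgebra maps, isomorphisms and convolution *)

Lemma is_coalgebra_map_comp (k : comPzRingType) (C D F : coalgType k) (f : {linear D -> F})
    (g : {linear C -> D}) :
  is_coalgebra_map f -> is_coalgebra_map g -> is_coalgebra_map (f \o g).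
Proof.
move=> cf cg; split=> c /=; last by rewrite cf.2 cg.2.
by rewrite cf.1 (tsum_comul_map _ cg) //; lin.
Qed.

Lemma hopf_iso_refl (k : comPzRingType) (H : hopfType k) : hopf_iso H H.
Proof.
exists idfun; last exact: (Bijective (g := id)).
by split=> //; split=> // h /=; exact: tensor_pureE.
Qed.

Lemma hopf_iso_sym (k : comPzRingType) (H K : hopfType k) :
  hopf_iso H K -> hopf_iso K H.
Proof.
move=> [f [f1 fM cf] [g fK gK]].
have lg : linear g.
  by move=> a x y; apply: (can_inj fK); rewrite linearP !gK.
exists (mk_linear lg); last exact: Bijective gK fK.
split.
- by apply: (can_inj fK); rewrite /= gK f1.
- by move=> x y; apply: (can_inj fK); rewrite /= fM !gK.
- split=> x; rewrite mk_linearE -[in RHS](gK x); last by rewrite cf.2.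
  rewrite (tsum_comul_map _ cf); last by lin.
  rewrite [LHS]tensor_pureE; apply: eq_tlift => y1 y2.
  by rewrite !mk_linearE !fK.
Qed.

Lemma hopf_iso_trans (k : comPzRingType) (H K L : hopfType k) :
  hopf_iso H K -> hopf_iso K L -> hopf_iso H L.
Proof.
move=> [f [f1 fM cf] bf] [g [g1 gM cg] bg].
exists (g \o f); last exact: bij_comp.
split; first by rewrite /= f1.
- by move=> x y; rewrite /= fM gM.
- exact: is_coalgebra_map_comp.
Qed.

(** Uniqueness of two-sided inverses in the convolution algebra Hom(C, B),
    with a left and a right inverse of the same g: both sides are f * g * h. *)
Lemma convolution_inverse_unique (k : comPzRingType) (C : coalgType k)
    (B : assocAlgType k) (f g h : {linear C -> B}) :
  (forall c, \tsum_(c1, c2 <- comul c) (f c1 ∙ g c2) = (counit c : k) *: (1%g : B)) ->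
  (forall c, \tsum_(c1, c2 <- comul c) (g c1 ∙ h c2) = (counit c : k) *: (1%g : B)) ->
  f =1 h.
Proof.
move=> fg gh c.
transitivity (\tsum_(c1, c2 <- comul c) \tsum_(d1, d2 <- comul c2)
   (f c1 ∙ g d1 ∙ h d2)).
  rewrite -(tsum_counitr c (f := f)); last by lin.
  apply: eq_tlift => c1 c2.
  rewrite -[X in X = _]amulr1 amulZl -amulZr -gh.
  rewrite (linear_tlift (g := fun z => f c1 ∙ z)); last by lin.
  by apply: eq_tlift => d1 d2; rewrite amulA.
rewrite -(coassoc (f := fun x y z => f x ∙ g y ∙ h z)); [|by move=> *; lin..].
rewrite -(tsum_counitl c (f := h)); last by lin.
apply: eq_tlift => c1 c2.
rewrite -(linear_tlift (g := fun z => z ∙ h c2)); last by lin.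
by rewrite fg amulZl amul1r.
Qed.

(** * Hopf algebra structure on a retract of a Hopf algebra *)

Section HopfRetract.
Variables (k : comPzRingType) (E C : hopfType k).

(** A coalgebra C embedded in E as a subalgebra, with a coalgebra retraction
    whose kernel is a right ideal ([ret_mull]): the ideal property is what
    yields the antipode.  Taking C among Hopf algebras places its carrier in
    the universe over which Hopf algebras range. *)
Record hopf_retract := HopfRetract {
  emb : {linear C -> E};
  ret : {linear E -> C};
  emb_coalgebra : is_coalgebra_map emb;
  ret_coalgebra : is_coalgebra_map ret;
  embK : cancel emb ret;
  emb_ret1 : emb (ret 1%g) = 1%g;
  emb_retM : forall x y, emb (ret (emb x ∙ emb y)) = emb x ∙ emb y;
  ret_mull : forall x y, ret (emb (ret x) ∙ y) = ret (x ∙ y)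
}.

(** The carrier C, renamed to receive the product pulled back from E. *)
Definition retract_hopf (w : hopf_retract) : Type := C.

Variable w : hopf_retract.
Local Notation B := (retract_hopf w).

HB.instance Definition _ := Coalgebra.copy B C.

Definition retract_emb : {linear B -> E} := emb w.
Definition retract_ret : {linear E -> B} := ret w.
Local Notation u := retract_emb.
Local Notation p := retract_ret.

Lemma retract_emb_coalgebra : is_coalgebra_map u.
Proof. exact: emb_coalgebra. Qed.
Lemma retract_ret_coalgebra : is_coalgebra_map p.
Proof. exact: ret_coalgebra. Qed.
Lemma retract_embK : cancel u p.
Proof. exact: embK. Qed.
Lemma retract_ret_mull x y : p (u (p x) ∙ y) = p (x ∙ y).
Proof. exact: ret_mull. Qed.
Lemma retract_emb_ret1 : u (p 1%g) = 1%g.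
Proof. exact: emb_ret1. Qed.

(* The operations keep their own names until all the structures are declared:
   before that, the generic notations on B would resolve to those of C. *)
Definition retract_mul (x y : B) : B := p (u x ∙ u y).
Definition retract_one : B := p 1%g.

Lemma emb_retract_mul x y : u (retract_mul x y) = u x ∙ u y.
Proof. exact: emb_retM. Qed.

Fact retract_mulA : associative retract_mul.
Proof.
by move=> x y z; apply: (can_inj retract_embK); rewrite !emb_retract_mul amulA.
Qed.
Fact retract_mul1l : left_id retract_one retract_mul.
Proof.
by move=> x; apply: (can_inj retract_embK); rewrite emb_retract_mul retract_emb_ret1 amul1r.
Qed.
Fact retract_mul1r : right_id retract_one retract_mul.
Proof.
by move=> x; apply: (can_inj retract_embK); rewrite emb_retract_mul retract_emb_ret1 amulr1.
Qed.
HB.instance Definition _ :=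
  monoid.isMonoid.Build B retract_mulA retract_mul1l retract_mul1r.

Fact retract_mulDl x y z :
  retract_mul (x + y) z = retract_mul x z + retract_mul y z.
Proof. by rewrite /retract_mul linearD amulDl linearD. Qed.
Fact retract_mulDr x y z :
  retract_mul x (y + z) = retract_mul x y + retract_mul x z.
Proof. by rewrite /retract_mul linearD amulDr linearD. Qed.
Fact retract_mulZl (c : k) x y :
  retract_mul (c *: x) y = c *: retract_mul x y.
Proof. by rewrite /retract_mul linearZZ amulZl linearZZ. Qed.
Fact retract_mulZr (c : k) x y :
  retract_mul x (c *: y) = c *: retract_mul x y.
Proof. by rewrite /retract_mul linearZZ amulZr linearZZ. Qed.
HB.instance Definition _ := isAssocAlgebra.Build k B
  retract_mulDl retract_mulDr retract_mulZl retract_mulZr.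

Fact retract_comulM x y : comul (retract_mul x y) =
  \tsum_(x1, x2 <- comul x) \tsum_(y1, y2 <- comul y)
    (retract_mul x1 y1 ⊗ retract_mul x2 y2).
Proof.
rewrite retract_ret_coalgebra.1 tsum_comulM; last by lin.
rewrite (tsum_comul_map _ retract_emb_coalgebra); last by lin.
apply: eq_tlift => x1 x2.
by rewrite (tsum_comul_map _ retract_emb_coalgebra) //; last by lin.
Qed.
Fact retract_comul1 : comul retract_one = retract_one ⊗ retract_one.
Proof.
by rewrite retract_ret_coalgebra.1 comul1 tlift_pure //; lin.
Qed.
Fact retract_counitM x y : counit (retract_mul x y) = counit x *: counit y.
Proof.
by rewrite retract_ret_coalgebra.2 counitM !retract_emb_coalgebra.2.
Qed.
Fact retract_counit1 : counit retract_one = 1.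
Proof. by rewrite retract_ret_coalgebra.2 counit1. Qed.
HB.instance Definition _ := isBialgebra.Build k B
  retract_comulM retract_comul1 retract_counitM retract_counit1.

Lemma retract_mulE (x y : B) : x ∙ y = p (u x ∙ u y).
Proof. by []. Qed.

Definition retract_antipode : {linear B -> B} := p \o antipode \o u.

(** Since ret (emb (ret x) y) = ret (x y), the left antipode identity for
    ret S emb is the image under ret of the one in E. *)
Fact retract_antipodel (h : B) :
  \tsum_(h1, h2 <- comul h) (retract_antipode h1 ∙ h2) = counit h *: (1%g : B).
Proof.
rewrite -[counit h]retract_emb_coalgebra.2 -[RHS](linearZZ p) -antipodel.
rewrite (tsum_comul_map _ retract_emb_coalgebra); last by lin.
rewrite linear_tlift; last by lin.
by apply: eq_tlift => h1 h2; rewrite retract_mulE retract_ret_mull.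
Qed.

(** The image of emb is stable under the antipode of E: emb (ret S emb) is a
    left convolution inverse of emb by [retract_antipodel], and S emb is a
    right one. *)
Lemma emb_retract_antipode (h : B) :
  u (retract_antipode h) = antipode (u h).
Proof.
apply: (@convolution_inverse_unique k B E (u \o retract_antipode)
  u (antipode \o u)) => c.
- transitivity (u (\tsum_(h1, h2 <- comul c) (retract_antipode h1 ∙ h2))).
    rewrite linear_tlift; last by lin.
    by apply: eq_tlift => h1 h2; rewrite -emb_retract_mul.
  by rewrite retract_antipodel [LHS]linearZZ retract_emb_ret1.
- rewrite -(tsum_comul_map (f := fun x y => x ∙ antipode y) _
    retract_emb_coalgebra); last by lin.
  by rewrite antipoder retract_emb_coalgebra.2.
Qed.

Fact retract_antipoder (h : B) :
  \tsum_(h1, h2 <- comul h) (h1 ∙ retract_antipode h2) = counit h *: (1%g : B).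
Proof.
rewrite -[counit h]retract_emb_coalgebra.2 -[RHS](linearZZ p) -antipoder.
rewrite (tsum_comul_map _ retract_emb_coalgebra); last by lin.
rewrite linear_tlift; last by lin.
by apply: eq_tlift => h1 h2; rewrite retract_mulE emb_retract_antipode.
Qed.
HB.instance Definition _ :=
  isHopf.Build k B retract_antipodel retract_antipoder.

Lemma emb_hopf : @is_hopf_map k B E u.
Proof.
split; [exact: emb_ret1|exact: emb_retract_mul|exact: emb_coalgebra].
Qed.

Definition retract_hopf_sub : hopf_sub E :=
  HopfSub emb_hopf (can_inj retract_embK) (ex_intro _ p retract_embK).

End HopfRetract.

(** * The automorphisms of A ⊗ H given by right convolution *)

Section Twist.
Variables (k : comPzRingType) (A H : hopfType k).
Implicit Types q : {linear H -> A}.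

Lemma twist_bilin q :
  bilin (fun (a : A) (h : H) => \tsum_(h1, h2 <- comul h) (a ∙ q h1 ⊗ h2)).
Proof. by lin. Qed.

Definition twist q : {linear (A ⊗ H)%type -> (A ⊗ H)%type} :=
  mk_linear (tlift_linear (twist_bilin q)).

Lemma twistE q a h :
  twist q (a ⊗ h) = \tsum_(h1, h2 <- comul h) (a ∙ q h1 ⊗ h2).
Proof. exact: tlift_pure (twist_bilin q). Qed.

(** Twisting by q and then by q' is twisting by the convolution product of q
    and q'. *)
Lemma twistK q q' :
  (forall h, \tsum_(h1, h2 <- comul h) (q h1 ∙ q' h2) =
    (counit h : k) *: (1%g : A)) ->
  cancel (twist q) (twist q').
Proof.
move=> qq'; apply: linear_tensor_ext; [by lin|by lin|] => a h.
rewrite twistE linear_tlift; last by lin.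
transitivity (\tsum_(h1, h2 <- comul h) \tsum_(d1, d2 <- comul h2)
   (a ∙ (q h1 ∙ q' d1)) ⊗ d2).
  by apply: eq_tlift => h1 h2; rewrite twistE; apply: eq_tlift => d1 d2;
    rewrite amulA.
rewrite -(coassoc (f := fun x y z => (a ∙ (q x ∙ q' y)) ⊗ z));
  [|by move=> *; lin..].
rewrite -(tsum_counitl h (f := fun h => a ⊗ h)); last by lin.
apply: eq_tlift => h1 h2.
rewrite -(linear_tlift (g := fun z => (a ∙ z) ⊗ h2)); last by lin.
by rewrite qq' amulZr amulr1 tpureZl.
Qed.

Lemma twist_bij (r : {linear H -> A}) : is_coalgebra_map r ->
  bijective (twist r).
Proof.
move=> cr; exists (twist (antipode \o r)); apply: twistK => h.
- by rewrite -(tsum_comul_map (f := fun x y => x ∙ antipode y) _ cr);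
    [rewrite antipoder cr.2|lin].
- by rewrite -(tsum_comul_map (f := fun x y => antipode x ∙ y) _ cr);
    [rewrite antipodel cr.2|lin].
Qed.
End Twist.

(** * Graphs of maps from H to A *)

Arguments proj_A : simpl never.
Arguments proj_H : simpl never.

Section Graph.
Variables (k : comPzRingType) (E : hopfType k) (A : hopf_sub E).
Variable H : complement A.
Local Notation i := (Defs.incl A).
Local Notation j := (Defs.incl H).
Local Notation pA := (proj_A H).
Local Notation pH := (proj_H H).
Local Notation mp := (canonical_matched_pair H).

Section LinearMap.
Variable r : {linear H -> A}.

Lemma graph_linear :
  linear (fun h : H => \tsum_(h1, h2 <- comul h) (i (r h1) ∙ j h2)).
Proof. by lin. Qed.
Definition graph : {linear H -> E} := mk_linear graph_linear.
Arguments graph : simpl never.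

Lemma graphE h : graph h = \tsum_(h1, h2 <- comul h) (i (r h1) ∙ j h2).
Proof. by []. Qed.

Lemma proj_A_graph h : pA (graph h) = r h.
Proof.
rewrite graphE linear_tlift; last by lin.
rewrite -(tsum_counitr h (f := r)); last by lin.
by apply: eq_tlift => h1 h2; rewrite proj_AE.
Qed.

Lemma proj_A_mul_graph x g : pA (x ∙ graph g) = pA (x ∙ i (r g)).
Proof. by rewrite proj_A_mul proj_A_graph. Qed.

Lemma proj_H_compl_mul_graph h g :
  pH (j h ∙ graph g) = \tsum_(g1, g2 <- comul g) (mp_ract mp (h ⊗ r g1) ∙ g2).
Proof.
rewrite graphE (linear_tlift (g := fun z => pH (j h ∙ z))); last by lin.
by apply: eq_tlift => g1 g2; rewrite amulA proj_H_mulr [in RHS]can_ractE.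
Qed.

Lemma mul_graph x g : graph g ∙ x = \tsum_(g1, g2 <- comul g) (i (r g1) ∙ (j g2 ∙ x)).
Proof.
rewrite graphE (linear_tlift (g := fun z => z ∙ x)); last by lin.
by apply: eq_tlift => g1 g2; rewrite amulA.
Qed.
End LinearMap.

Lemma proj_H_graph (r : {linear H -> A}) h : is_coalgebra_map r ->
  pH (graph r h) = h.
Proof.
move=> cr; rewrite graphE linear_tlift; last by lin.
rewrite -[RHS]counitl; apply: eq_tlift => h1 h2.
by rewrite proj_HE cr.2.
Qed.

(** In E every x is the sum of pA(x_1) pH(x_2); for x = w(h) the second factor
    is h_2. *)
Lemma graph_proj_A (w : {linear H -> E}) : is_coalgebra_map w ->
  (forall h, pH (w h) = h) -> graph (pA \o w) =1 w.
Proof.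
move=> cw pw h; rewrite -[RHS](proj_decomp H) (tsum_comul_map _ cw); last by lin.
by apply: eq_tlift => h1 h2; rewrite pw.
Qed.

(** The coproduct of the graph is r(h_1) h_3 ⊗ r(h_2) h_4, while the tensor
    square of the graph on h_1 ⊗ h_2 is r(h_1) h_2 ⊗ r(h_3) h_4; cocentrality
    exchanges the two middle factors. *)
Lemma graph_coalgebra (r : {linear H -> A}) : is_coalgebra_map r ->
  (forall h, \tsum_(h1, h2 <- comul h) (r h1 ⊗ h2) =
     \tsum_(h1, h2 <- comul h) (r h2 ⊗ h1)) ->
  is_coalgebra_map (graph r).
Proof.
have [_ _ ci] := incl_hopf A; have [_ _ cj] := incl_hopf H.
move=> cr cc; split=> h; last first.
  rewrite graphE linear_tlift; last by lin.
  rewrite -(tsum_counitl h (f := counit)); last by lin.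
  apply: eq_tlift => h1 h2; by rewrite counitM ci.2 cj.2 cr.2.
rewrite graphE linear_tlift; last by lin.
transitivity (\tsum_(h1, h2 <- comul h) \tsum_(d1, d2 <- comul h1)
   \tsum_(e1, e2 <- comul h2) ((i (r d1) ∙ j e1) ⊗ (i (r d2) ∙ j e2))).
  apply: eq_tlift => h1 h2.
  rewrite [LHS]tensor_pureE tsum_comul_incl; last by lin.
  by rewrite (tsum_comul_map _ cr); last by lin.
rewrite (coassoc (f := fun x y z => \tsum_(e1, e2 <- comul z)
  ((i (r x) ∙ j e1) ⊗ (i (r y) ∙ j e2)))); [|by move=> *; lin..].
transitivity (\tsum_(h1, h2 <- comul h) \tsum_(d1, d2 <- comul h2)
   \tsum_(e1, e2 <- comul d1) ((i (r h1) ∙ j e1) ⊗ (i (r e2) ∙ j d2))).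
  apply: eq_tlift => h1 h2.
  rewrite -(coassoc (f := fun x y z =>
    (i (r h1) ∙ j y) ⊗ (i (r x) ∙ j z))); [|by move=> *; lin..].
  apply: eq_tlift => d1 d2.
  (* Cocentrality at d1, under the bilinear map sending a ⊗ x to the summand. *)
  have bf : bilin (fun (a : A) (x : H) => (i (r h1) ∙ j x) ⊗ (i a ∙ j d2)) by lin.
  have := congr1 (tlift (fun (a : A) (x : H) => (i (r h1) ∙ j x) ⊗ (i a ∙ j d2)))
    (cc d1).
  rewrite !(linear_tlift _ _ (tlift_linear bf)) => e.
  transitivity (\tsum_(m, n <- comul d1) tlift (fun (a : A) (x : H) =>
       (i (r h1) ∙ j x) ⊗ (i a ∙ j d2)) (r m ⊗ n)).
    by apply: eq_tlift => e1 e2; rewrite tlift_pure.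
  by rewrite e; apply: eq_tlift => e1 e2; rewrite tlift_pure.
transitivity (\tsum_(h1, h2 <- comul h) \tsum_(d1, d2 <- comul h2)
   \tsum_(e1, e2 <- comul d2) ((i (r h1) ∙ j d1) ⊗ (i (r e1) ∙ j e2))).
  apply: eq_tlift => h1 h2.
  by rewrite (coassoc (f := fun x y z => (i (r h1) ∙ j x) ⊗ (i (r y) ∙ j z)));
    [|move=> *; lin..].
rewrite -(coassoc (f := fun x y z => \tsum_(e1, e2 <- comul z)
    ((i (r x) ∙ j y) ⊗ (i (r e1) ∙ j e2)))); [|by move=> *; lin..].
apply: eq_tlift => h1 h2.
rewrite !graphE (linear_tlift (g := fun z => z ⊗ _)); last by lin.
apply: eq_tlift => d1 d2.
by rewrite (linear_tlift (g := tpure _)); last by lin.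
Qed.

Lemma graph1 (r : {linear H -> A}) : r 1%g = 1%g -> graph r 1%g = 1%g.
Proof.
move=> r1; rewrite graphE comul1 tlift_pure; last by lin.
by rewrite r1 !incl1 amul1r.
Qed.

(** The deformation equation says that r(pH(u v)) = pA(u v) for u and v in the
    graph, i.e. that the A-component of u v is the one that a point of the
    graph over pH(u v) has; u v is then recovered from its components. *)
Lemma graph_deformation_eq (r : {linear H -> A}) :
  is_coalgebra_map (graph r) -> is_deformation_map mp r ->
  forall h g, graph r (pH (graph r h ∙ graph r g)) = graph r h ∙ graph r g.
Proof.
move=> cg dr h g.
have pHM x y : pH (graph r x ∙ graph r y) = pH (j x ∙ graph r y).
  by rewrite proj_H_mul proj_H_graph //; exact: dm_coalgebra dr.
have rM x y : r (pH (graph r x ∙ graph r y)) = pA (graph r x ∙ graph r y).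
  rewrite pHM proj_H_compl_mul_graph (dm_eq dr) mul_graph.
  rewrite linear_tlift; last by lin.
  apply: eq_tlift => x1 x2.
  by rewrite proj_A_mull proj_A_mul_graph [X in _ ∙ X]can_lactE.
rewrite -[RHS](proj_decomp H) graphE.
rewrite (tsum_comul_map _ (proj_H_coalgebra H)); last by lin.
rewrite !tsum_comulM; [|by lin..].
rewrite !(tsum_comul_map _ cg); [|by lin..].
apply: eq_tlift => h1 h2.
rewrite !(tsum_comul_map _ cg); [|by lin..].
by apply: eq_tlift => g1 g2; rewrite rM.
Qed.

(** The converse: cocentrality of r is [proj_cocentral] along the graph, and
    the deformation equation is the A-component of closedness. *)
Lemma deformation_map_of_graph (r : {linear H -> A}) :
  is_coalgebra_map r -> is_coalgebra_map (graph r) -> graph r 1%g = 1%g ->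
  (forall h g, graph r (pH (graph r h ∙ graph r g)) = graph r h ∙ graph r g) ->
  is_deformation_map mp r.
Proof.
move=> cr cg g1 gM; split=> // [|h|g h].
- by rewrite -proj_A_graph g1 -(incl1 A) proj_A_incl.
- have := congr1 (tlift (fun (x : H) (a : A) => a ⊗ x))
    (proj_cocentral H (graph r h)).
  rewrite !(tsum_comul_map _ cg); [|by lin..].
  rewrite !(linear_tlift (g := tlift _)); [|by lin..] => e.
  transitivity (\tsum_(h1, h2 <- comul h) tlift (fun (x : H) (a : A) => a ⊗ x)
     (pH (graph r h2) ⊗ pA (graph r h1))).
    apply: eq_tlift => h1 h2.
    by rewrite tlift_pure; [rewrite proj_H_graph // proj_A_graph|lin].
  rewrite -e; apply: eq_tlift => h1 h2.
  by rewrite tlift_pure; [rewrite proj_H_graph // proj_A_graph|lin].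
- rewrite -proj_H_compl_mul_graph -{1}(proj_H_graph h cr) -proj_H_mul.
  rewrite -proj_A_graph gM mul_graph linear_tlift; last by lin.
  apply: eq_tlift => h1 h2.
  by rewrite proj_A_mull proj_A_mul_graph [in RHS]can_lactE.
Qed.

(** * The complement given by a deformation map *)

Section Deformation.
Arguments graph : simpl never.
Variable r : deformation_map mp.

Lemma dm_graph_coalgebra : is_coalgebra_map (graph r).
Proof.
by apply: graph_coalgebra; [exact: dm_coalgebra (dmP r)|exact: dm_cocentral (dmP r)].
Qed.
Lemma dm_graphK : cancel (graph r) pH.
Proof. by move=> h; apply: proj_H_graph; exact: dm_coalgebra (dmP r). Qed.
Lemma proj_H_1 : pH 1%g = 1%g.
Proof. by rewrite -(incl1 H) proj_H_compl. Qed.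
Lemma dm_graph_ret1 : graph r (pH 1%g) = 1%g.
Proof. by rewrite proj_H_1 graph1 //; exact: dm_unit (dmP r). Qed.
Lemma dm_graphM h g : graph r (pH (graph r h ∙ graph r g)) = graph r h ∙ graph r g.
Proof. exact: graph_deformation_eq dm_graph_coalgebra (dmP r) h g. Qed.
Lemma dm_graph_ret_mull x y : pH (graph r (pH x) ∙ y) = pH (x ∙ y).
Proof. by rewrite proj_H_mul dm_graphK -proj_H_mul. Qed.

Definition deformation_retract : hopf_retract E H :=
  HopfRetract dm_graph_coalgebra (proj_H_coalgebra H) dm_graphK dm_graph_ret1
    dm_graphM dm_graph_ret_mull.

Lemma deformation_mulE (h g : retract_hopf deformation_retract) :
  h ∙ g = \tsum_(g1, g2 <- comul (g : H)) (mp_ract mp ((h : H) ⊗ r g1) ∙ g2).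
Proof.
by rewrite retract_mulE -proj_H_compl_mul_graph -[RHS]dm_graph_ret_mull proj_H_compl.
Qed.

Lemma mul_incl_twist t : mul_incl A H (twist r t) =
   mul_incl A (retract_hopf_sub deformation_retract) t.
Proof.
move: t; apply: linear_tensor_ext; [by lin|by lin|] => a h.
rewrite twistE linear_tlift; last by lin.
rewrite [RHS]tlift_pure; last exact: mul_incl_bilin.
rewrite /mul_incl_fun [X in _ ∙ X]graphE (linear_tlift (g := fun z => _ ∙ z)); last by lin.
by apply: eq_tlift => h1 h2; rewrite mul_inclE inclM amulA.
Qed.

Lemma deformation_complement_bij :
  bijective (mul_incl A (retract_hopf_sub deformation_retract)).
Proof.
apply: (eq_bij (bij_comp (compl_bij H) (twist_bij (dm_coalgebra (dmP r))))).
exact: mul_incl_twist.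
Qed.

Definition deformation_complement : complement A :=
  Complement deformation_complement_bij.
End Deformation.

(** The two complements share the carrier coalgebra H, and by
    [deformation_mulE] the identity required of σ is multiplicativity for their
    products. *)
Lemma deformation_equivE (r R : deformation_map mp) :
  deformation_equiv r R <->
  hopf_iso (deformation_complement r) (deformation_complement R).
Proof.
have mulE (s : {linear H -> H}) g h : is_coalgebra_map s ->
    \tsum_(g1, g2 <- comul g) (mp_ract mp (s h ⊗ R (s g1)) ∙ s g2) =
    @monoid.mul (retract_hopf (deformation_retract R)) (s h) (s g).
  move=> cs; rewrite deformation_mulE (tsum_comul_map _ cs) //.
  by lin.
(* The carriers are convertible to H but their units and products are not those
   of H: [fun z : H => s z] reads each equation in H. *)
split.
- case=> s [bs cs s1 sM]; exists s => //; split=> //.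
  + by change (s (pH 1%g) = pH 1%g); rewrite proj_H_1.
  + move=> x y; refine (etrans (f_equal (fun z : H => s z) (deformation_mulE x y)) _).
    by etransitivity; [exact: sM|exact: mulE].
- case=> s [s1 sM cs] bs; exists s; split=> // [|g h].
  + exact: etrans (f_equal (fun z : H => s z) (esym proj_H_1)) (etrans s1 proj_H_1).
  + refine (etrans (f_equal (fun z : H => s z) (esym (@deformation_mulE r h g))) _).
    by etransitivity; [exact: sM|exact: (esym (mulE s g h cs))].
Qed.

(** For x = a k with a in A and k in K, pH sends both x and its K-component
    ε(a) k to ε(a) pH(k). *)
Lemma proj_H_complement (K : complement A) x :
  pH (Defs.incl K (proj_H K x)) = pH x.
Proof.
move: x; apply: (compl_ext (H := K)) => [||a x]; [by lin|by lin|].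
by rewrite proj_HE linearZZ linearZZ proj_H_mull.
Qed.

(** By symmetry the restrictions of the projections to the two complements are
    mutually inverse. *)
Lemma compl_projK (K : complement A) :
  cancel (proj_H K \o j) (pH \o Defs.incl K).
Proof. by move=> h; rewrite [LHS]proj_H_complement proj_H_compl. Qed.
End Graph.

(** * The deformation map of a complement *)

Section Transport.
Variables (k : comPzRingType) (E : hopfType k) (A : hopf_sub E).
Variables H K : complement A.
Local Notation j := (Defs.incl H).
Local Notation l := (Defs.incl K).
Local Notation pA := (proj_A H).
Local Notation pH := (proj_H H).
Local Notation mp := (canonical_matched_pair H).

Definition compl_change : {linear H -> K} := proj_H K \o j.
(** The section of pH whose image is K. *)
Definition compl_section : {linear H -> E} := l \o compl_change.

Lemma compl_sectionE h : compl_section h = l (proj_H K (j h)).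
Proof. by []. Qed.

Lemma compl_changeK : cancel compl_change (pH \o l).
Proof. exact: compl_projK. Qed.
Lemma compl_changeKV : cancel (pH \o l) compl_change.
Proof. exact: compl_projK. Qed.

Lemma compl_section_coalgebra : is_coalgebra_map compl_section.
Proof.
have [_ _ cj] := incl_hopf H; have [_ _ cl] := incl_hopf K.
apply: is_coalgebra_map_comp => //; apply: is_coalgebra_map_comp => //.
exact: proj_H_coalgebra.
Qed.

Definition compl_deformation_fun : {linear H -> A} := pA \o compl_section.

Lemma compl_graphE : graph compl_deformation_fun =1 compl_section.
Proof.
exact: graph_proj_A compl_section_coalgebra compl_changeK.
Qed.

Lemma compl_deformationP : is_deformation_map mp compl_deformation_fun.
Proof.
apply: deformation_map_of_graph.
- exact: is_coalgebra_map_comp (proj_A_coalgebra H) compl_section_coalgebra.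
- split=> h.
  + rewrite compl_graphE compl_section_coalgebra.1.
    by apply: eq_tlift => h1 h2; rewrite !compl_graphE.
  + by rewrite compl_graphE compl_section_coalgebra.2.
- by rewrite compl_graphE compl_sectionE incl1 proj_H_1 incl1.
- move=> h g; rewrite !compl_graphE !compl_sectionE -inclM.
  by rewrite [X in l X = _]compl_changeKV.
Qed.

Definition compl_deformation : deformation_map mp :=
  DeformationMap compl_deformationP.

(** K and the graph of its deformation map have the same image in E, so the
    coalgebra isomorphism pH from K to H respects the products. *)
Lemma compl_iso : hopf_iso K (deformation_complement compl_deformation).
Proof.
have [_ _ cl] := incl_hopf K.
exists (pH \o l).
  split.
  - by change (pH (l 1%g) = pH 1%g); rewrite incl1.
  - move=> x y; change (pH (l (x ∙ y)) = pH (graph compl_deformation_fun (pH (l x)) ∙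
      graph compl_deformation_fun (pH (l y)))).
    rewrite !compl_graphE !compl_sectionE.
    by rewrite ![X in l X ∙ _]compl_changeKV ![X in _ ∙ l X]compl_changeKV inclM.
  - exact: is_coalgebra_map_comp (proj_H_coalgebra H) cl.
exact: Bijective compl_changeKV compl_changeK.
Qed.
End Transport.

(** * The classification *)

(** Taking preimages of classes goes from S to T, so that no representatives
    need to be chosen: the preimage of the class of f x is the class of x. *)
Lemma preimage_classes_bij (S T : Type) (RS : S -> S -> Prop)
    (RT : T -> T -> Prop) (f : T -> S) :
  (forall x, RS x x) -> (forall x y, RS x y -> RS y x) ->
  (forall x y z, RS x y -> RS y z -> RS x z) ->
  (forall x y, RT x y <-> RS (f x) (f y)) ->
  (forall y, exists x, RS y (f x)) ->
  set_bij (classes RS) (classes RT) (fun c => f @^-1` c)%classic.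
Proof.
move=> RSxx RSC RST RTE f_surj.
have RS_eq x y : RS x y -> RS x = RS y.
  by move=> xy; apply/funext => z; apply/propext; split; apply: RST => //; apply: RSC.
have preE x : (f @^-1` RS (f x))%classic = RT x.
  by apply/funext => y; apply/propext; split=> /RTE.
split.
- move=> _ [y _ <-]; have [x yx] := f_surj y.
  by exists x => //; rewrite (RS_eq _ _ yx) preE.
- move=> _ _ /set_mem[y _ <-] /set_mem[z _ <-] yz.
  have [x yx] := f_surj y; rewrite (RS_eq _ _ yx).
  apply/esym/RS_eq.
  by change ((f @^-1` RS z)%classic x); rewrite -yz.
- move=> _ [x _ <-]; exists (RS (f x)); last exact: preE.
  by exists (f x).
Qed.

Theorem theorem2p5 (k : comPzRingType) (E : hopfType k) (A : hopf_sub E)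
    (H : complement A) :
  let mp : matched_pair A H := canonical_matched_pair H in
  RelationClasses.Equivalence (@deformation_equiv k A H mp) /\
  (exists F : set (complement A) -> set (deformation_map mp),
      set_bij (complement_classes A) (HA2 mp) F) /\
  has_factorization_index A (HA2 mp).
Proof.
move=> mp.
have bij : set_bij (complement_classes A) (HA2 mp)
    (fun c => @deformation_complement k E A H @^-1` c)%classic.
  apply: preimage_classes_bij => [K|K L|K L M|r R|K].
  - exact: hopf_iso_refl.
  - exact: hopf_iso_sym.
  - exact: hopf_iso_trans.
  - exact: deformation_equivE.
  - by exists (compl_deformation H K); exact: compl_iso.
split; last split.
- split=> [r|r R|q r R]; rewrite !deformation_equivE.
  + exact: hopf_iso_refl.
  + exact: hopf_iso_sym.
  + exact: hopf_iso_trans.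
- by eexists; exact: bij.
- by apply/card_set_bijP; eexists; exact: bij.
Qed.
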